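(* Let $\{U^n\}_{n=0}^N$ be a solution of the CNFD scheme. Then for all $n=1,\dots,N$, $$\|U^n\|_{2,h}^2\le\|U^0\|_{2,h}^2.$$
   Context: Constants: $\lambda\in\mathbb{R}$, $\nu>0$, $\varepsilon\ge 0$, $T>0$; $\Omega=(a,b)\times(c,d)\subset\mathbb{R}^2$; $u_0:\overline\Omega\to\mathbb{C}$, vanishing on $\partial\Omega$. Grid: $x_j=a+j\Delta x$, $\Delta x=(b-a)/J$, $y_k=c+k\Delta y$, $\Delta y=(d-c)/K$, for $0\le j\le J$, $0\le k\le K$, with $\Delta x=\Delta y=h$. Time grid: $t_n=n\tau$, $n=0,\dots,N$, $N\tau=T$. $\mathcal{T}_{JK}=\{(j,k):1\le j\le J-1,\ 1\le k\le K-1\}$. $X_{JK}$ is the space of complex grid functions $u=(u_{j,k})_{0\le j\le J,\,0\le k\le K}$ with $u_{0,k}=u_{J,k}=u_{j,0}=u_{j,K}=0$ for all $j,k$. Difference operators: $\delta_t^+u^n_{j,k}=(u^{n+1}_{j,k}-u^n_{j,k})/\tau$, $\delta^2u_{j,k}=\frac{u_{j+1,k}-2u_{j,k}+u_{j-1,k}}{(\Delta x)^2}+\frac{u_{j,k+1}-2u_{j,k}+u_{j,k-1}}{(\Delta y)^2}$. Norm: $\|u\|_{2,h}^2=\Delta x\Delta y\sum_{j=0}^{J-1}\sum_{k=0}^{K-1}|u_{j,k}|^2$. For $z,w\in\mathbb{C}$: $\psi_1(z,w)=\frac{|z|^2+|w|^2}{2}\cdot\frac{z+w}{2}$, $\psi_2(z,w)=\frac{|z|^4+|z|^2|w|^2+|w|^4}{3}\cdot\frac{z+w}{2}$,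 $\varphi(z,w)=\left|\frac{z+w}{2}\right|^2\frac{z+w}{2}$. CNFD scheme: $\{U^n\}_{n=0}^N$ is a solution if $U^0_{j,k}=u_0(x_j,y_k)$, $U^{n+1}\in X_{JK}$ for $n=0,\dots,N-1$, and, with $U^{n+1/2}=\frac12(U^{n+1}+U^n)$, for all $(j,k)\in\mathcal{T}_{JK}$ and $n=0,\dots,N-1$, $$i\delta_t^+U^n_{j,k}+\delta^2U^{n+1/2}_{j,k}+\lambda\psi_1(U^{n+1}_{j,k},U^n_{j,k})-\nu\psi_2(U^{n+1}_{j,k},U^n_{j,k})+i\varepsilon\varphi(U^{n+1}_{j,k},U^n_{j,k})=0.$$ *)

(* Defs.v *)
From HB Require Import structures.
From mathcomp Require Import all_boot all_order all_algebra.
From mathcomp Require Import all_classical all_reals all_analysis.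
From mathcomp Require Import complex.

Set Implicit Arguments.
Unset Strict Implicit.
Unset Printing Implicit Defensive.

Import Order.TTheory GRing.Theory Num.Theory.
Import numFieldNormedType.Exports.

Local Open Scope classical_set_scope.
Local Open Scope complex_scope.
Local Open Scope ring_scope.

Section Domain.
Context {R : realType}.

Definition rectangle (a b c d : R) : set (R * R) := `]a, b[ `*` `]c, d[.

Definition boundary (A : set (R * R)) : set (R * R) := closure A `\` interior A.

Definition mesh (a b : R) (J : nat) : R := (b - a) / J%:R.
Definition node (a b : R) (J j : nat) : R := a + j%:R * mesh a b J.

End Domain.

(* A grid function is indexed by nat * nat; only its values at the indices
   0 <= j <= J, 0 <= k <= K are ever used or constrained. *)
Definition gridfun (R : realType) := nat -> nat -> R[i].

Section Scheme.
Context {R : realType}.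

Definition interior_index (J K j k : nat) : Prop :=
  (1 <= j <= J.-1)%N /\ (1 <= k <= K.-1)%N.

Definition X_space (J K : nat) (u : gridfun R) : Prop :=
  (forall k, (k <= K)%N -> u 0%N k = 0 /\ u J k = 0) /\
  (forall j, (j <= J)%N -> u j 0%N = 0 /\ u j K = 0).

Definition delta_t (tau : R) (U : nat -> gridfun R) (n j k : nat) : R[i] :=
  (U n.+1 j k - U n j k) / tau%:C.

Definition delta2 (dx dy : R) (u : gridfun R) (j k : nat) : R[i] :=
  (u j.+1 k - 2 * u j k + u j.-1 k) / (dx%:C) ^+ 2 +
  (u j k.+1 - 2 * u j k + u j k.-1) / (dy%:C) ^+ 2.

Definition half_step (U : nat -> gridfun R) (n : nat) : gridfun R :=
  fun j k => (U n.+1 j k + U n j k) / 2.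

(* Normc.normc is the modulus with values in R; `|z| is the same number
   viewed in R[i]. *)
Definition norm2h (dx dy : R) (J K : nat) (u : gridfun R) : R :=
  Num.sqrt (dx * dy *
    \sum_(0 <= j < J) \sum_(0 <= k < K) Normc.normc (u j k) ^+ 2).

Definition psi1 (z w : R[i]) : R[i] :=
  (`|z| ^+ 2 + `|w| ^+ 2) / 2 * ((z + w) / 2).

Definition psi2 (z w : R[i]) : R[i] :=
  (`|z| ^+ 4 + `|z| ^+ 2 * `|w| ^+ 2 + `|w| ^+ 4) / 3 * ((z + w) / 2).

Definition phi (z w : R[i]) : R[i] := `|(z + w) / 2| ^+ 2 * ((z + w) / 2).

Definition CNFD_solution (lambda nu eps a b c d tau : R) (J K N : nat)
    (u0 : R * R -> R[i]) (U : nat -> gridfun R) : Prop :=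
  [/\ forall j k, (j <= J)%N -> (k <= K)%N ->
        U 0%N j k = u0 (node a b J j, node c d K k),
      forall n, (n < N)%N -> X_space J K (U n.+1) &
      forall n j k, (n < N)%N -> interior_index J K j k ->
        'i%C * delta_t tau U n j k
        + delta2 (mesh a b J) (mesh c d K) (half_step U n) j k
        + lambda%:C * psi1 (U n.+1 j k) (U n j k)
        - nu%:C * psi2 (U n.+1 j k) (U n j k)
        + 'i%C * eps%:C * phi (U n.+1 j k) (U n j k) = 0].

End Scheme.

(* Main.v *)
Require Import Defs.
From mathcomp Require Import all_boot all_order all_algebra.
From mathcomp Require Import all_classical all_reals all_analysis.
From mathcomp Require Import complex.
From mathcomp Require Import ring lra.
Import Order.TTheory GRing.Theory Num.Theory.
Import numFieldNormedType.Exports.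


(** The scheme is a discrete Schrodinger equation, and the claim is the discrete
    form of mass dissipation.  Put V = (U^{n+1} + U^n) / 2, multiply the scheme
    by the conjugate of V and take imaginary parts.  The time difference gives
    (|U^{n+1}|^2 - |U^n|^2) / (2 tau); the terms in lambda and nu are real
    multiples of V and contribute nothing; the damping term gives
    eps |V|^4 >= 0; and the Laplacian gives Im (conj V * delta^2 V).  This
    pointwise identity is [local_mass_balance].

    The Laplacian term is a discrete divergence: each of its two directional
    parts is the difference of the flux Im (conj V_j * V_{j+1}) across
    neighbouring edges ([cross_delta2]).  Summed over the interior nodes it
    telescopes to fluxes through boundary edges, which vanish because V does on
    the boundary ([sum_cross_delta2]).  Hence the mass does not grow in a step
    ([CNFD_mass_step]), and the theorem follows by induction on n.

    The scheme puts U^1, ..., U^N in the space of grid functions vanishing on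
    the boundary; for U^0 this comes from the boundary values of u_0, once the
    boundary nodes are known to lie on the topological boundary of the rectangle
    ([X_space_initial]). *)

Local Open Scope ring_scope.

(** * Complex numbers through their real and imaginary parts *)

Local Notation Re := complex.Re.
Local Notation Im := complex.Im.

Section ComplexParts.
Context {R : realType}.
Implicit Types (x y z w : R[i]) (r : R).

Lemma normc_sqr z : Normc.normc z ^+ 2 = Re z ^+ 2 + Im z ^+ 2.
Proof. by case: z => p q /=; rewrite sqr_sqrtr ?addr_ge0 ?sqr_ge0. Qed.

Lemma ReD x y : Re (x + y) = Re x + Re y. Proof. by case: x y => ? ? []. Qed.
Lemma ImD x y : Im (x + y) = Im x + Im y. Proof. by case: x y => ? ? []. Qed.
Lemma ReN x : Re (- x) = - Re x. Proof. by case: x. Qed.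
Lemma ImN x : Im (- x) = - Im x. Proof. by case: x. Qed.
Lemma ReM x y : Re (x * y) = Re x * Re y - Im x * Im y.
Proof. by case: x y => ? ? []. Qed.
Lemma ImM x y : Im (x * y) = Re x * Im y + Im x * Re y.
Proof. by case: x y => ? ? []. Qed.

Definition ReImE := (ReD, ImD, ReN, ImN, ReM, ImM).

Lemma natc n : n%:R = n%:R%:C%C :> R[i].
Proof. by rewrite (rmorph_nat (real_complex R)). Qed.

Lemma invc_real r : (r%:C^-1 = r^-1%:C)%C.
Proof. by rewrite (fmorphV (real_complex R)). Qed.

Lemma Re_scale r x : Re (r%:C%C * x) = r * Re x.
Proof. by rewrite ReM /= mul0r subr0. Qed.

Lemma Im_scale r x : Im (r%:C%C * x) = r * Im x.
Proof. by rewrite ImM /= mul0r addr0. Qed.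

(** * The pointwise mass balance *)

(** This is Im (conj z * w), the symplectic form of the plane: it is what remains
    of a term w of the scheme after pairing with z and taking imaginary parts,
    and it kills every real multiple of z. *)
Definition cross z w : R := Re z * Im w - Im z * Re w.

Lemma cross_scale r z w : cross z (r%:C%C * w) = r * cross z w.
Proof. by rewrite /cross Re_scale Im_scale; ring. Qed.

Lemma crossD z w y : cross z (w + y) = cross z w + cross z y.
Proof. by rewrite /cross ReD ImD; ring. Qed.

(** Antisymmetry of [cross] turns a second difference centred at z into a
    difference of two fluxes: the central value drops out and the term in w
    changes sign. *)
Lemma cross_second_difference z w y :
  cross z (y - 2 * z + w) = cross z y - cross w z.
Proof. by rewrite /cross natc !(Re_scale, Im_scale, ReImE); ring. Qed.

(** The nonlinearities enter the mass balance only through the fact that they are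
    real multiples of the midpoint. *)
Lemma psi1_real z w : exists r, psi1 z w = r%:C%C * ((z + w) / 2).
Proof.
exists ((Normc.normc z ^+ 2 + Normc.normc w ^+ 2) / 2); congr (_ * _).
by rewrite !(fmorphV, rmorphM, rmorphD, rmorphXn, rmorph_nat).
Qed.

Lemma psi2_real z w : exists r, psi2 z w = r%:C%C * ((z + w) / 2).
Proof.
exists ((Normc.normc z ^+ 4 + Normc.normc z ^+ 2 * Normc.normc w ^+ 2
  + Normc.normc w ^+ 4) / 3); congr (_ * _).
by rewrite !(fmorphV, rmorphM, rmorphD, rmorphXn, rmorph_nat).
Qed.

(** The scheme at one node and one time step, with L standing for the Laplacian
    of the midpoint.  The left side arises as Re (conj (w + z) * (w - z)), which
    is the reason for evaluating all terms at the midpoint. *)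
Lemma local_mass_balance (lambda nu eps tau : R) (L z w : R[i]) :
    tau != 0 ->
    'i%C * ((w - z) / tau%:C%C) + L + lambda%:C%C * psi1 w z
      - nu%:C%C * psi2 w z + 'i%C * eps%:C%C * phi w z = 0 ->
  Normc.normc w ^+ 2 - Normc.normc z ^+ 2
    = - (2 * tau) * (cross ((w + z) / 2) L
        + eps * Normc.normc ((w + z) / 2) ^+ 4).
Proof.
move=> tau0; have [s1 ->] := psi1_real w z; have [s2 ->] := psi2_real w z.
set v := (w + z) / 2 => tau_eq.
have vRe : Re w + Re z = 2 * Re v.
  by rewrite /v natc invc_real [_ * _%:C%C]mulrC Re_scale ReD; field.
have vIm : Im w + Im z = 2 * Im v.
  by rewrite /v natc invc_real [_ * _%:C%C]mulrC Im_scale ImD; field.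
move: tau_eq; rewrite /phi -/v; clearbody v.
rewrite -add_Re2_Im2 -normc_sqr invc_real.
rewrite [_ * tau^-1%:C%C]mulrC (exprM _ 2 2).
move: (normc_sqr v); set m := Normc.normc v ^+ 2 => mE eq0.
have /eqP := congr1 (@complex.Re R) eq0; have /eqP := congr1 (@complex.Im R) eq0.
rewrite -!mulrA !(Re_scale, Im_scale, ReImE) /= => /eqP eIm /eqP eRe.
rewrite !normc_sqr /cross.
(* The two real components of the equation, solved for the increment w - z;
   pairing them with w + z = 2 v cancels the terms in s1 and s2. *)
have dRe : Re w - Re z
    = - tau * (Im L + (lambda * s1 - nu * s2) * Im v + eps * m * Re v).
  have -> : Re w - Re z = tau * (tau^-1 * (Re w - Re z)) by field.
  by rewrite mulNr -mulrN; congr (_ * _); move: eIm; lra.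
have dIm : Im w - Im z
    = tau * (Re L + (lambda * s1 - nu * s2) * Re v - eps * m * Im v).
  have -> : Im w - Im z = tau * (tau^-1 * (Im w - Im z)) by field.
  by congr (_ * _); move: eRe; lra.
have -> : Re w ^+ 2 + Im w ^+ 2 - (Re z ^+ 2 + Im z ^+ 2)
    = (Re w - Re z) * (Re w + Re z) + (Im w - Im z) * (Im w + Im z) by ring.
by rewrite dRe dIm vRe vIm mE; ring.
Qed.

End ComplexParts.

(** * Summation over the grid *)

(** The norm sums over 0 <= j < J, while the scheme holds at 1 <= j <= J - 1;
    for functions vanishing on the first row and column the two sums agree. *)
Lemma sum_drop_first (R : realType) J K (f : nat -> nat -> R) :
    (forall k, (k <= K)%N -> f 0%N k = 0) ->
    (forall j, (j <= J)%N -> f j 0%N = 0) ->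
  \sum_(0 <= j < J.+1) \sum_(0 <= k < K.+1) f j k
    = \sum_(0 <= j < J) \sum_(0 <= k < K) f j.+1 k.+1.
Proof.
move=> f0k fj0; rewrite big_nat_recl //.
have -> : \sum_(0 <= k < K.+1) f 0%N k = 0.
  by rewrite big_nat big1 // => k; exact: f0k.
rewrite add0r; apply: eq_big_nat => j jJ.
by rewrite big_nat_recl // fj0 ?add0r.
Qed.

Section Grid.
Context {R : realType}.

(** The discrete divergence form of the Laplacian term; j.+1 and k.+1 range over
    the interior indices, so that predecessors carry no truncation. *)
Lemma cross_delta2 dx dy (u : gridfun R) j k :
  cross (u j.+1 k.+1) (delta2 dx dy u j.+1 k.+1) =
    (cross (u j.+1 k.+1) (u j.+2 k.+1) - cross (u j k.+1) (u j.+1 k.+1))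
      / dx ^+ 2
    + (cross (u j.+1 k.+1) (u j.+1 k.+2) - cross (u j.+1 k) (u j.+1 k.+1))
      / dy ^+ 2.
Proof.
rewrite /delta2 crossD -!rmorphXn /= !invc_real.
rewrite ![_ * _^-1%:C%C]mulrC !cross_scale !cross_second_difference.
by rewrite ![_^-1 * _]mulrC.
Qed.

(** No flux leaves the grid: after telescoping along each row and each column,
    every remaining edge has an endpoint on the boundary, where u vanishes. *)
Lemma sum_cross_delta2 dx dy J K (u : gridfun R) : X_space J.+1 K.+1 u ->
  \sum_(0 <= j < J) \sum_(0 <= k < K)
    cross (u j.+1 k.+1) (delta2 dx dy u j.+1 k.+1) = 0.
Proof.
move=> [ux uy]; have crossr0 z : cross z 0 = 0 by rewrite /cross /=; ring.
have cross0r z : cross 0 z = 0 by rewrite /cross /=; ring.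
under eq_bigr do under eq_bigr do rewrite cross_delta2.
under eq_bigr do rewrite big_split /=.
rewrite big_split /= exchange_big /= [X in _ + X]big_nat [X in X + _]big_nat.
rewrite !big1 ?addr0 // => [j|k] /andP[_ lt]; rewrite -mulr_suml.
  have [ul ur] := uy j.+1 (leqW lt).
  rewrite (telescope_sumr (fun k => cross (u j.+1 k) (u j.+1 k.+1))) //.
  by rewrite ul ur crossr0 cross0r subrr mul0r.
have [ul ur] := ux k.+1 (leqW lt).
rewrite (telescope_sumr (fun j => cross (u j k.+1) (u j.+1 k.+1))) //.
by rewrite ul ur crossr0 cross0r subrr mul0r.
Qed.

Lemma X_space_half_step J K (U : nat -> gridfun R) n :
  X_space J K (U n) -> X_space J K (U n.+1) -> X_space J K (half_step U n).
Proof.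
move=> [x0 y0] [x1 y1]; split=> [k kK|j jJ]; rewrite /half_step.
  by have [-> ->] := x0 k kK; have [-> ->] := x1 k kK; rewrite addr0 mul0r.
by have [-> ->] := y0 j jJ; have [-> ->] := y1 j jJ; rewrite addr0 mul0r.
Qed.

Lemma norm2h_sqr dx dy J K (u : gridfun R) :
    0 <= dx -> 0 <= dy -> X_space J.+1 K.+1 u ->
  norm2h dx dy J.+1 K.+1 u ^+ 2
    = dx * dy * \sum_(0 <= j < J) \sum_(0 <= k < K)
        Normc.normc (u j.+1 k.+1) ^+ 2.
Proof.
move=> dx0 dy0 [ux uy]; rewrite /norm2h sqr_sqrtr; last first.
  rewrite !mulr_ge0 //; apply: sumr_ge0 => j _; apply: sumr_ge0 => k _.
  exact: sqr_ge0.
congr (_ * _).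
rewrite (sum_drop_first R J K (fun j k => Normc.normc (u j k) ^+ 2)) //.
  by move=> k kK; have [-> _] := ux k (leqW kK); rewrite Normc.normc0 expr0n.
by move=> j jJ; have [-> _] := uy j (leqW jJ); rewrite Normc.normc0 expr0n.
Qed.

(** * The initial datum vanishes at the boundary nodes *)

Lemma closure_oo (a b x : R) : a < b -> a <= x <= b -> closure `]a, b[%classic x.
Proof.
move=> ab /andP[ax xb] B /nbhs_ballP[e /= e0 eB].
have ba0 : 0 < b - a by rewrite subr_gt0.
(* Move from x towards the midpoint of the interval, by a fraction s <= 1 small
   enough to stay in the ball: the displacement is at most s (b - a) / 2. *)
pose s := Num.min 1 (e / (b - a)).
have s0 : 0 < s by rewrite lt_min ltr01 divr_gt0.
have s1 : s <= 1 by rewrite ge_min lexx.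
have se : s * (b - a) <= e by rewrite -ler_pdivlMr // ge_min lexx orbT.
exists (x + s * ((a + b) / 2 - x)); split.
  by rewrite /= in_itv /=; apply/andP; split; nra.
by apply: eB; rewrite /ball /= ltr_norml; apply/andP; split; nra.
Qed.

Lemma closure_setX (A B : set R) (x y : R) :
  closure A x -> closure B y -> closure (A `*` B)%classic (x, y).
Proof.
move=> Ax By C [[P Q] /= [xP yQ] PQC].
have [p [Ap Pp]] := Ax P xP; have [q [Bq Qq]] := By Q yQ.
by exists (p, q); split=> //; apply: PQC.
Qed.

(** The rectangle contains its interior, so a point of the closed rectangle lying
    outside the open one cannot be interior. *)
Lemma boundary_rectangle (a b c d x y : R) :
    a < b -> c < d -> a <= x <= b -> c <= y <= d ->
    ~~ ((a < x < b) && (c < y < d)) ->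
  boundary (rectangle a b c d) (x, y).
Proof.
move=> ab cd xab ycd out; split.
  by apply: closure_setX; exact: closure_oo.
move=> /interior_subset[/= xo yo]; move/negP: out; apply.
by move: xo yo; rewrite !in_itv /= => -> ->.
Qed.

Lemma node_last (a b : R) J : (0 < J)%N -> node a b J J = b.
Proof.
move=> J0; have /negPf JN0 : J%:R != 0 :> R by rewrite pnatr_eq0 -lt0n.
by rewrite /node /mesh mulrC divfK ?JN0 // addrC subrK.
Qed.

Lemma node_first (a b : R) J : node a b J 0 = a.
Proof. by rewrite /node mul0r addr0. Qed.

Lemma mesh_gt0 (a b : R) J : a < b -> (0 < J)%N -> 0 < mesh a b J.
Proof. by move=> ab J0; rewrite divr_gt0 ?subr_gt0 ?ltr0n. Qed.

Lemma node_itv (a b : R) J j : a < b -> (0 < J)%N -> (j <= J)%N ->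
  a <= node a b J j <= b.
Proof.
move=> ab J0 jJ; have m0 := mesh_gt0 a b J ab J0.
have -> : (a <= node a b J j <= b)
    = (node a b J 0 <= node a b J j <= node a b J J).
  by rewrite node_first node_last.
by rewrite !lerD2l !ler_pM2r // !ler_nat leq0n.
Qed.

Lemma X_space_initial (a b c d : R) J K (u0 : R * R -> R[i]) (u : gridfun R) :
    a < b -> c < d -> (0 < J)%N -> (0 < K)%N ->
    (forall p, boundary (rectangle a b c d) p -> u0 p = 0) ->
    (forall j k, (j <= J)%N -> (k <= K)%N ->
      u j k = u0 (node a b J j, node c d K k)) ->
  X_space J K u.
Proof.
move=> ab cd J0 K0 u0_bd uE; split=> [k kK|j jJ]; split; rewrite uE //;
  apply: u0_bd; apply: boundary_rectangle => //; try exact: node_itv;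
  by rewrite ?node_first ?node_last ?ltxx ?andbF.
Qed.

(** * Mass dissipation *)

(** Summing the mass balance over the interior nodes removes the flux terms and
    leaves only the damping, which enters with the factor - 2 tau eps <= 0. *)
Lemma CNFD_mass_step (lambda nu eps a b c d tau : R) J K N
    (u0 : R * R -> R[i]) (U : nat -> gridfun R) n :
    0 <= eps -> 0 < tau -> a < b -> c < d ->
    CNFD_solution lambda nu eps a b c d tau J.+1 K.+1 N u0 U ->
    X_space J.+1 K.+1 (U n) -> (n < N)%N ->
  norm2h (mesh a b J.+1) (mesh c d K.+1) J.+1 K.+1 (U n.+1) ^+ 2
    <= norm2h (mesh a b J.+1) (mesh c d K.+1) J.+1 K.+1 (U n) ^+ 2.
Proof.
move=> eps0 tau0 ab cd [_ UX Ueq] Xn nN; have Xn1 := UX n nN.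
set dx := mesh a b _; set dy := mesh c d _.
have dx0 : 0 < dx := mesh_gt0 a b J.+1 ab isT.
have dy0 : 0 < dy := mesh_gt0 c d K.+1 cd isT.
rewrite !norm2h_sqr ?(ltW dx0) ?(ltW dy0) //.
rewrite ler_pM2l ?(mulr_gt0 dx0 dy0) // -subr_le0.
rewrite -sumrB; under eq_bigr do rewrite -sumrB.
pose V := half_step U n.
pose dissipation := \sum_(0 <= j < J) \sum_(0 <= k < K)
  eps * Normc.normc (V j.+1 k.+1) ^+ 4.
have -> : \sum_(0 <= j < J) \sum_(0 <= k < K)
    (Normc.normc (U n.+1 j.+1 k.+1) ^+ 2 - Normc.normc (U n j.+1 k.+1) ^+ 2)
  = - (2 * tau) * (\sum_(0 <= j < J) \sum_(0 <= k < K)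
      cross (V j.+1 k.+1) (delta2 dx dy V j.+1 k.+1) + dissipation).
  rewrite -big_split mulr_sumr; apply: eq_big_nat => j /andP[_ jJ].
  rewrite -big_split mulr_sumr; apply: eq_big_nat => k /andP[_ kK].
  apply: (local_mass_balance lambda nu); first by rewrite gt_eqF.
  exact: Ueq.
rewrite sum_cross_delta2 ?add0r; last exact: X_space_half_step.
rewrite mulNr oppr_le0; apply: mulr_ge0; first by rewrite mulr_ge0 // ltW.
apply: sumr_ge0 => j _; apply: sumr_ge0 => k _.
by rewrite mulr_ge0 // (exprM _ 2 2) sqr_ge0.
Qed.

End Grid.

Theorem lemma3p2 (R : realType)
  (lambda nu eps T : R) (hnu : 0 < nu) (heps : 0 <= eps) (hT : 0 < T)
  (a b c d : R) (hab : a < b) (hcd : c < d)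
  (u0 : R * R -> R[i])
  (hu0 : forall p, boundary (rectangle a b c d) p -> u0 p = 0)
  (J K : nat) (hJ : (0 < J)%N) (hK : (0 < K)%N)
  (h : R) (hx : mesh a b J = h) (hy : mesh c d K = h)
  (N : nat) (tau : R) (htau : N%:R * tau = T)
  (U : nat -> gridfun R)
  (hU : CNFD_solution lambda nu eps a b c d tau J K N u0 U) :
  forall n, (1 <= n <= N)%N ->
    norm2h (mesh a b J) (mesh c d K) J K (U n) ^+ 2
      <= norm2h (mesh a b J) (mesh c d K) J K (U 0%N) ^+ 2.
Proof.
(* The time step is positive because N steps of length tau reach T > 0. *)
have tau0 : 0 < tau.
  by move: hT; rewrite -htau; have := ler0n R N; nra.
have [U0E UX _] := hU.
have X_all n : (n <= N)%N -> X_space J K (U n).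
  case: n => [_|n]; last exact: UX.
  exact: (X_space_initial a b c d J K u0).
case: J K hJ hK => [//|J] [//|K] _ _ in hx hy hU U0E UX X_all *.
suff mass_le n : (n <= N)%N ->
  norm2h (mesh a b J.+1) (mesh c d K.+1) J.+1 K.+1 (U n) ^+ 2
    <= norm2h (mesh a b J.+1) (mesh c d K.+1) J.+1 K.+1 (U 0%N) ^+ 2.
  by move=> n /andP[_]; exact: mass_le.
elim: n => // n IHn nN; apply: le_trans (IHn (ltnW nN)).
apply: (CNFD_mass_step lambda nu eps a b c d tau J K N u0) => //.
exact: X_all (ltnW nN).
Qed.
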